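(* Let $a$ be an integer with $a>2$. The Pell equation $x^{2}-\left(a^{2}+2a\right)y^{2}=-4$ has no positive integer solutions. *)

(** Multiplication by the unit [(a+1) - sqrt (a^2+2a)] of norm 1 sends a
    solution [(x, y)] to one with second coordinate [(a+1) y - x].  For [a > 2]
    every positive solution satisfies [a y < x < (a+1) y], so this coordinate
    lies strictly between [0] and [y]: infinite descent. *)
From Stdlib Require Import ZArith.
From Stdlib Require Import Lia.

(** The equation gives [x^2 - (a y)^2 = 2 a y^2 - 4], positive as [a > 2], and
    [((a+1) y)^2 - x^2 = y^2 + 4]. *)
Lemma pell_solution_bounds (a x y : Z) :
  (2 < a -> 0 <= x -> 0 < y -> x ^ 2 - (a ^ 2 + 2 * a) * y ^ 2 = -4 ->
   a * y < x < (a + 1) * y)%Z.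
Proof.
  intros ha hx hy e; split.
  - assert (hlt : ((a * y) ^ 2 < x ^ 2)%Z) by nia.
    apply Z.pow_lt_mono_l_iff in hlt; lia.
  - assert (hlt : (x ^ 2 < ((a + 1) * y) ^ 2)%Z) by nia.
    apply Z.pow_lt_mono_l_iff in hlt; nia.
Qed.

(** Strong induction on [y], with [x] quantified inside because the descent changes it; [0 <= x] is
    all that an absolute value guarantees. *)
Lemma no_pell_solution (a : Z) (ha : (2 < a)%Z) (y : Z) :
  (0 <= y -> forall x, 0 <= x -> 0 < y ->
   x ^ 2 - (a ^ 2 + 2 * a) * y ^ 2 <> -4)%Z.
Proof.
  intros hy0; pattern y; apply Zlt_0_ind; [clear y hy0 | exact hy0].
  intros y IH _ x hx hy e.
  destruct (pell_solution_bounds a x y ha hx hy e) as [hlo hhi].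
  (* The descended first coordinate may be negative, hence the [Z.abs]. *)
  apply (IH ((a + 1) * y - x)%Z ltac:(lia)
            (Z.abs ((a + 1) * x - (a ^ 2 + 2 * a) * y))); [lia | lia |].
  rewrite <- Z.pow_even_abs by (exists 1%Z; reflexivity).
  (* With [-4] replaced by the norm of [(x, y)], invariance of the norm is a polynomial identity, as
     [(a+1)^2 - (a^2+2a) = 1]. *)
  rewrite <- e; ring.
Qed.

(* Stdlib integers *)
Theorem theorem11 (a : Z) (ha : (2 < a)%Z) :
  ~ (exists x y : Z,
       (0 < x /\ 0 < y /\ x ^ 2 - (a ^ 2 + 2 * a) * y ^ 2 = -4)%Z).
Proof.
  intros (x & y & hx & hy & e).
  exact (no_pell_solution a ha y ltac:(lia) x ltac:(lia) hy e).
Qed.
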